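(* Let $c\in\{-1,0,1\}$, let $\alpha\in[0,\pi/2]$, and let $\gamma:[0,\ell]\to M_c$ be a smooth, closed, convex curve with geodesic curvature $k=k(s)$. Let $\rho_\alpha:[0,\ell]\to\mathbb{R}$ be the function assigning to each $s$ the value of $t$ at which the differential of the family $\mathcal{F}_\alpha$ is singular, i.e. such that $(D\mathcal{F}_\alpha)_{(s,\rho_\alpha(s))}$ does not have full rank (for $c=1$, $\rho_\alpha(s)$ is the smallest nonnegative such $t$). Then $$\rho_\alpha(s)=\arctan_c\left(\frac{\sin\alpha}{k(s)}\right)\qquad\text{for all } s\in[0,\ell].$$ That is, the $\alpha$-evolutoid of $\gamma$ is parametrized by $$\gamma_\alpha(s)=\exp^c_{\gamma(s)}\big(\rho_\alpha(s)\,\mathbf{v}_\alpha(s)\big).$$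
   Context: Space forms: for $c\in\{-1,0,1\}$ equip $\mathbb{R}^3$ with $\langle x,y\rangle_c=c\,x_1y_1+x_2y_2+x_3y_3$ and $\|x\|_c=\sqrt{\langle x,x\rangle_c}$. Let $M_{-1}=\{x:\langle x,x\rangle_{-1}=-1,\ x_1>0\}$, $M_0=\{x: x_1=0\}$, $M_1=\{x:\langle x,x\rangle_1=1\}$, each with the Riemannian metric induced by $\langle\cdot,\cdot\rangle_c$ (constant Gaussian curvature $c$). Trigonometry: $\sin_c(t)=\sinh t,\ t,\ \sin t$ and $\cos_c(t)=\cosh t,\ 1,\ \cos t$ for $c=-1,0,1$ respectively; $\tan_c=\sin_c/\cos_c$ and $\arctan_c$ is its inverse (principal value for $c=1$). For $p\in M_c$, a unit vector $v\in T_pM_c$ and $t\in\mathbb{R}$, the exponential map is $\exp^c_p(tv)=\cos_c(t)\,p+\sin_c(t)\,v$. Frenet frame: for an arc-length parametrized curve $\gamma$ in $M_c$, $\mathbf{t}=\gamma'$ and $\mathbf{e}=\gamma\wedge_c\mathbf{t}$ if $c=\pm1$, where $x\wedge_c y=(c(x_2y_3-x_3y_2),\,x_3y_1-x_1y_3,\,x_1y_2-x_2y_1)$, while $\mathbf{e}=\gamma''/\|\gamma''\|_0$ if $c=0$. The geodesic curvature $k$ is defined by $\nabla_{\gamma'}\gamma'=k\,\mathbf{e}$ ($\nabla$ the Levi-Civita connection). A smooth, closed, positively oriented, arc-length parametrized curve is called convex if $k(s)>0$ for all $s$ (when $c=0,1$) or $k(s)>1$ for all $s$ (when $c=-1$).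 Evolutoids: $\mathbf{v}_\alpha(s)=\cos(\alpha)\mathbf{t}(s)+\sin(\alpha)\mathbf{e}(s)$ and $\mathcal{F}_\alpha(s,t)=\exp^c_{\gamma(s)}(t\,\mathbf{v}_\alpha(s))$ for $s\in[0,\ell]$, $t\in[0,\infty)$. The $\alpha$-evolutoid of $\gamma$ is the image under $\mathcal{F}_\alpha$ of the set of critical points $(s,t)$ of $\mathcal{F}_\alpha$. For $c=1$ this set consists of two copies that are antipodal to each other, and only the copy obtained from the smallest nonnegative critical $t$ is considered. *)

(* Defs.v *)
From mathcomp Require Import all_boot all_order all_algebra.
From mathcomp Require Import all_classical all_reals all_analysis.
Import Order.TTheory GRing.Theory Num.Theory numFieldNormedType.Exports.

Set Implicit Arguments.
Unset Strict Implicit.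
Unset Printing Implicit Defensive.

Local Open Scope classical_set_scope.
Local Open Scope ring_scope.

(* A point x = (x_1, x_2, x_3) of R^3 is a row vector whose coordinate x_i is
   x 0 (i - 1).  The curvature c is a real number; the definitions by cases
   are meant for c = -1, 0, 1 only, the last branch being the remaining case. *)

Definition vec3 (R : realType) (a b d : R) : 'rV[R]_3 :=
  \row_(i < 3) [:: a; b; d]`_i.

Definition dotc (R : realType) (c : R) (x y : 'rV[R]_3) : R :=
  c * x 0 0 * y 0 0 + x 0 1 * y 0 1 + x 0 2 * y 0 2.

Definition normc (R : realType) (c : R) (x : 'rV[R]_3) : R :=
  Num.sqrt (dotc c x x).

Definition space_form (R : realType) (c : R) : set 'rV[R]_3 :=
  if c == -1 then [set x : 'rV[R]_3 | dotc (-1) x x = -1 /\ 0 < x 0 0]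
  else if c == 0 then [set x : 'rV[R]_3 | x 0 0 = 0]
  else [set x : 'rV[R]_3 | dotc 1 x x = 1].

Definition wedgec (R : realType) (c : R) (x y : 'rV[R]_3) : 'rV[R]_3 :=
  vec3 (c * (x 0 1 * y 0 2 - x 0 2 * y 0 1))
       (x 0 2 * y 0 0 - x 0 0 * y 0 2)
       (x 0 0 * y 0 1 - x 0 1 * y 0 0).

Definition sinh (R : realType) (t : R) : R := (expR t - expR (- t)) / 2.
Definition cosh (R : realType) (t : R) : R := (expR t + expR (- t)) / 2.

Definition sinc (R : realType) (c t : R) : R :=
  if c == -1 then sinh t else if c == 0 then t else sin t.

Definition cosc (R : realType) (c t : R) : R :=
  if c == -1 then cosh t else if c == 0 then 1 else cos t.

Definition tanc (R : realType) (c t : R) : R := sinc c t / cosc c t.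

(* The inverse of tanc c, on the principal branch when c = 1 (same convention
   as the library's atan); unspecified outside the range of tanc c. *)
Definition arctanc (R : realType) (c x : R) : R :=
  get [set t : R | (c = 1 -> - (pi / 2) < t < pi / 2) /\ tanc c t = x].

(* exp_p (t v), for a unit tangent vector v at p *)
Definition expc (R : realType) (c : R) (p : 'rV[R]_3) (t : R) (v : 'rV[R]_3)
    : 'rV[R]_3 :=
  cosc c t *: p + sinc c t *: v.

(* A smooth closed curve on [0, l] is represented by its smooth l-periodic
   extension to the real line. *)
Definition smooth (R : realType) (g : R -> 'rV[R]_3) : Prop :=
  forall (n : nat) (s : R), derivable (derive1n n g) s 1.

Definition closed_curve (R : realType) (l : R) (g : R -> 'rV[R]_3) : Prop :=
  0 < l /\ forall s, g (s + l) = g s.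

Definition arclength_param (R : realType) (c : R) (g : R -> 'rV[R]_3) : Prop :=
  forall s, normc c (derive1 g s) = 1.

Definition frame_t (R : realType) (g : R -> 'rV[R]_3) (s : R) : 'rV[R]_3 :=
  derive1 g s.

Definition frame_e (R : realType) (c : R) (g : R -> 'rV[R]_3) (s : R)
    : 'rV[R]_3 :=
  if c == 0 then (normc 0 (derive1n 2 g s))^-1 *: derive1n 2 g s
  else wedgec c (g s) (frame_t g s).

(* Levi-Civita covariant derivative of a tangent vector field X along g: the
   <,>_c-orthogonal projection of X' to the tangent plane at g s.  For
   c = 1, -1 that plane is the orthogonal complement of g s, and
   <g s, g s>_c = c = 1 / c; for c = 0 the ambient derivative is already
   tangent. *)
Definition covariant_derivative (R : realType) (c : R) (g X : R -> 'rV[R]_3)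
    (s : R) : 'rV[R]_3 :=
  derive1 X s - (c * dotc c (derive1 X s) (g s)) *: g s.

(* When c = 0 the vector e(s) is only defined where g'' s <> 0; without this
   clause the equation would leave k s arbitrary at points where g'' s = 0. *)
Definition geodesic_curvature (R : realType) (c l : R) (g : R -> 'rV[R]_3)
    (k : R -> R) : Prop :=
  forall s, 0 <= s <= l ->
    (c = 0 -> derive1n 2 g s <> 0) /\
    covariant_derivative c g (frame_t g) s = k s *: frame_e c g s.

(* The unit normal to M_c orienting it *)
Definition surface_normal (R : realType) (c : R) (p : 'rV[R]_3) : 'rV[R]_3 :=
  if c == 0 then vec3 1 0 0 else p.

(* The frame (t, e) is a positive basis of the tangent plane.  For c = 1, -1
   this holds by definition of e, and the orientation of the curve is encoded in
   the sign of k; for c = 0, where e points to the side to which the curve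
   bends, it says that the curve turns counterclockwise. *)
Definition positively_oriented (R : realType) (c l : R) (g : R -> 'rV[R]_3)
    : Prop :=
  forall s, 0 <= s <= l ->
    0 < \det (\matrix_(i < 3)
      [:: surface_normal c (g s); frame_t g s; frame_e c g s]`_i).

Definition convex_curvature (R : realType) (c l : R) (k : R -> R) : Prop :=
  forall s, 0 <= s <= l -> if c == -1 then 1 < k s else 0 < k s.

Definition v_alpha (R : realType) (c alpha : R) (g : R -> 'rV[R]_3) (s : R)
    : 'rV[R]_3 :=
  cos alpha *: frame_t g s + sin alpha *: frame_e c g s.

Definition F_alpha (R : realType) (c alpha : R) (g : R -> 'rV[R]_3) (s t : R)
    : 'rV[R]_3 :=
  expc c (g s) t (v_alpha c alpha g s).

(* The Jacobian matrix of (s, t) |-> F_alpha s t; F_alpha takes its values in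
   the surface, so full rank means rank 2. *)
Definition DF_alpha (R : realType) (c alpha : R) (g : R -> 'rV[R]_3) (s t : R)
    : 'M[R]_(2, 3) :=
  'J (fun p : 'rV[R]_2 => F_alpha c alpha g (p 0 0) (p 0 1))
     (\row_(i < 2) [:: s; t]`_i).

Definition critical_point (R : realType) (c alpha l : R) (g : R -> 'rV[R]_3)
    (s t : R) : Prop :=
  [/\ 0 <= s <= l, 0 <= t & (\rank (DF_alpha c alpha g s t) < 2)%N].

(* The critical points that are retained: all of them when c = 0, -1, the one
   with the smallest t >= 0 on each geodesic when c = 1. *)
Definition retained_critical_point (R : realType) (c alpha l : R)
    (g : R -> 'rV[R]_3) (s t : R) : Prop :=
  critical_point c alpha l g s t /\
  (c = 1 -> forall t', critical_point c alpha l g s t' -> t <= t').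

Definition singular_time (R : realType) (c alpha l : R) (g : R -> 'rV[R]_3)
    (rho : R -> R) : Prop :=
  forall s, 0 <= s <= l -> retained_critical_point c alpha l g s (rho s).

Definition evolutoid (R : realType) (c alpha l : R) (g : R -> 'rV[R]_3)
    : set 'rV[R]_3 :=
  [set x | exists s t, retained_critical_point c alpha l g s t /\
                       x = F_alpha c alpha g s t].

(* Main.v *)
Require Import Defs.
From mathcomp Require Import all_boot all_order all_algebra.
From mathcomp Require Import all_classical all_reals all_analysis.
From mathcomp Require Import ring lra.
Import Order.TTheory GRing.Theory Num.Theory numFieldNormedType.Exports.
Local Open Scope classical_set_scope.
Local Open Scope ring_scope.

Set Implicit Arguments.
Unset Strict Implicit.

(** Write T, E for the frame of the curve, C = cos_c t, S = sin_c t and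
    v = cos alpha T + sin alpha E.  In the three geometries alike the Frenet
    equations are T' = k E - c gamma and E' = - k T, while C' = - c S and
    S' = C, so the partial derivatives of F(s, t) = C gamma + S v are

      dF/dt = - c S gamma + C v,
      dF/ds = C T + S (cos alpha (k E - c gamma) - k sin alpha T).

    The first is the unit velocity of the geodesic issued from gamma in the
    direction v; the vector w = sin alpha T - cos alpha E, orthogonal to v, is
    the unit normal to that geodesic at each of its points.  The variation field
    dF/ds of this family of geodesics splits along these two directions as

      dF/ds = cos alpha dF/dt + (C sin alpha - k S) w.

    Since dF/dt and w are always independent (this uses C^2 + c S^2 = 1), the
    differential is singular exactly when k S = C sin alpha, i.e. when
    tan_c t = sin alpha / k ([singular_jacobian]).  Convexity makes the quotient
    nonnegative, and smaller than 1 when c = -1, so that arctan_c of it is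
    defined and nonnegative; it is the only nonnegative solution when c = -1, 0
    and the smallest one when c = 1 ([arctanc_first]).  The retained critical
    points are therefore the pairs (s, arctan_c (sin alpha / k s)), from which
    both assertions follow.

    The Frenet equation for E' is where the geometries differ.  For c = 1, -1 it
    comes from differentiating E = gamma x T.  For c = 0, where E is the
    normalization of T', the orientation hypothesis identifies E with T turned
    by a right angle; by continuity this persists near s, also when s is an
    endpoint of [0, l], so E can be differentiated there. *)

(** * Trigonometry of the three geometries *)

Lemma trigcE (R : realType) :
  ((sinc (-1) = @sinh R) * (sinc 0 = id :> (R -> R)) * (sinc 1 = @sin R)) *
  ((cosc (-1) = @cosh R) * (cosc 0 = cst 1 :> (R -> R)) * (cosc 1 = @cos R)).
Proof.
have n01 : (0 == -1 :> R) = false by apply/eqP; lra.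
have n11 : (1 == -1 :> R) = false by apply/eqP; lra.
by do !split; apply/funext => t; rewrite /sinc /cosc ?eqxx ?n01 ?n11 ?oner_eq0.
Qed.

Lemma cosc_sq_sinc_sq (R : realType) (c t : R) :
  [\/ c = -1, c = 0 | c = 1] -> cosc c t ^+ 2 + c * sinc c t ^+ 2 = 1.
Proof.
case=> ->; rewrite !trigcE.
- have : expR t * expR (- t) = 1 by rewrite -expRD subrr expR0.
  rewrite /cosh /sinh; nra.
- by rewrite mul0r addr0 expr1n.
- by rewrite mul1r cos2Dsin2.
Qed.

Lemma is_derive_cosc (R : realType) (c t : R) :
  [\/ c = -1, c = 0 | c = 1] ->
  is_derive t 1 (cosc c) (- (c * sinc c t)).
Proof.
case=> ->; rewrite !trigcE.
- rewrite /cosh /sinh.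
  have -> : (fun t : R => (expR t + expR (- t)) / 2) =
      2^-1 *: (expR + (expR \o -%R)) by apply/funext => x /=; rewrite mulrC.
  apply: is_derive_eq => /=; rewrite /GRing.scale /=; lra.
- by rewrite mul0r oppr0; exact: is_derive_cst.
- by rewrite mul1r; exact: is_derive_cos.
Qed.

Lemma is_derive_sinc (R : realType) (c t : R) :
  [\/ c = -1, c = 0 | c = 1] -> is_derive t 1 (sinc c) (cosc c t).
Proof.
case=> ->; rewrite !trigcE.
- rewrite /cosh /sinh.
  have -> : (fun t : R => (expR t - expR (- t)) / 2) =
      2^-1 *: (expR - (expR \o -%R)) by apply/funext => x /=; rewrite mulrC.
  apply: is_derive_eq => /=; rewrite /GRing.scale /=; lra.
- exact: is_derive_id.
- exact: is_derive_sin.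
Qed.

(** Multiplying by expR t turns the equation into
    expR (2 t) = (1 + m) / (1 - m). *)
Lemma tanh_solution (R : realType) (m : R) : -1 < m < 1 ->
  exists2 t0 : R, sinh t0 = m * cosh t0 &
    forall t, sinh t = m * cosh t -> t = t0.
Proof.
case/andP=> m1 m2.
have eqE t : sinh t = m * cosh t <-> expR (t + t) = (1 + m) / (1 - m).
  have e0 := expR_gt0 t.
  have E1 : expR (- t) * expR t = 1 by rewrite -expRD addNr expR0.
  rewrite expRD /sinh /cosh; split=> H.
  + have H' : expR t * (1 - m) = expR (- t) * (1 + m) by lra.
    have -> : expR t * expR t = (expR t * (1 - m)) * expR t / (1 - m).
      by field; lra.
    rewrite H'; have -> : expR (- t) * (1 + m) * expR t = 1 + m.
      by rewrite mulrAC E1 mul1r.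
    by [].
  + have H' : expR t * expR t * (1 - m) = 1 + m by rewrite H; field; lra.
    suff : expR t * (1 - m) = expR (- t) * (1 + m) by lra.
    by rewrite -H' !mulrA E1 mul1r.
have q0 : 0 < (1 + m) / (1 - m) by apply: divr_gt0; lra.
exists (ln ((1 + m) / (1 - m)) / 2) => [|t /eqE H].
  by apply/eqE; rewrite -splitr lnK.
by rewrite -H expRK; lra.
Qed.

(** In the hyperbolic plane a ray meets the condition tan_c t = m only if m < 1,
    the range of tanh; on the sphere the solutions repeat with period pi, hence
    minimality in place of uniqueness. *)
Lemma arctanc_first (R : realType) (c m : R) :
  [\/ c = -1, c = 0 | c = 1] -> 0 <= m -> (c = -1 -> m < 1) ->
  [/\ 0 <= arctanc c m, sinc c (arctanc c m) = m * cosc c (arctanc c m) &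
    forall t, 0 <= t -> sinc c t = m * cosc c t ->
      arctanc c m <= t /\ (c <> 1 -> t = arctanc c m)].
Proof.
move=> hc m0 m1.
have tancE t : cosc c t != 0 -> (tanc c t = m <-> sinc c t = m * cosc c t).
  move=> c0; rewrite /tanc; split=> [<-|->]; first by rewrite divfK.
  by rewrite mulfK.
(* It is enough to find a solution in the principal domain that is unique there:
   uniqueness identifies it with the value selected by arctanc, and for c = 1 a
   nonnegative solution smaller than t0 would lie in the domain as well. *)
suff [t0 [t00 d0 ct0 st0 ut0]] : exists t0, [/\ 0 <= t0,
    c = 1 -> - (pi / 2) < t0 < pi / 2, cosc c t0 != 0,
    sinc c t0 = m * cosc c t0 &
    forall t, (c = 1 -> - (pi / 2) < t < pi / 2) ->
      cosc c t != 0 /\ (sinc c t = m * cosc c t -> t = t0)].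
  have -> : arctanc c m = t0.
    apply: get_unique; first by split=> //; apply/tancE.
    by move=> t [dt /tancE]; case: (ut0 t dt) => ct u H; apply/u/H.
  split=> // t tge0 st.
  have [c1|c1] := pselect (c = 1); last first.
    have dt : c = 1 -> - (pi / 2) < t < pi / 2 by [].
    by have [_ /(_ st) ->] := ut0 t dt.
  split=> //; have [//|tt0] := leP t0 t.
  have dt : c = 1 -> - (pi / 2) < t < pi / 2.
    move=> _; have /andP[] := d0 c1; have := pi_gt0 R => *; lra.
  by have [_ /(_ st) tE] := ut0 t dt; rewrite tE ltxx in tt0.
case: hc m1 {tancE} => -> m1.
- have mm : -1 < m < 1 by have := m1 erefl; lra.
  have [t0 st0 ut0] := tanh_solution mm.
  have coshp t : 0 < @cosh R t.
    by rewrite /cosh; have := expR_gt0 t; have := expR_gt0 (- t); lra.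
  rewrite !trigcE.
  exists t0; split=> //; last 2 first.
  + by rewrite gt_eqF.
  + by move=> t _; rewrite gt_eqF //; split=> //; exact: ut0.
  + have [//|t0n] := leP 0 t0.
    have : expR t0 < expR (- t0) by rewrite ltr_expR; lra.
    have := coshp t0; move: st0; rewrite /sinh /cosh => *; nra.
  + lra.
- rewrite !trigcE; exists m; split=> //.
  + lra.
  + by rewrite oner_eq0.
  + by rewrite mulr1.
  + by move=> t _; rewrite oner_eq0 mulr1.
- have cp t : - (pi / 2) < t < pi / 2 -> 0 < @cos R t.
    by move=> ?; exact: cos_gt0_pihalf.
  rewrite !trigcE; exists (atan m).
  have da : - (pi / 2) < atan m < pi / 2 by rewrite atan_gtNpi2 atan_ltpi2.
  split=> //.
  + by rewrite -(@atan0 R) le_atan.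
  + by rewrite gt_eqF // cp.
  + by rewrite -[X in _ = X * _]atanK /tan divfK // gt_eqF // cp.
  + move=> t /(_ erefl) dt; have ct := cp _ dt; rewrite gt_eqF //; split=> // st.
    by rewrite -(@tanK R t) ?in_itv //= /tan st mulfK // gt_eqF.
Qed.

(** * Linear algebra *)

(** A is the product of the triangular matrix with rows (d, a) and (0, 1) by B,
    and multiplying by a matrix with independent rows preserves the rank. *)
Lemma rank_triangular_rows (F : fieldType) n (a d : F) (A B : 'M[F]_(2, n)) :
  row_free B -> row 0 A = d *: row 0 B + a *: row 1 B -> row 1 A = row 1 B ->
  (\rank A < 2)%N = (d == 0).
Proof.
move=> freeB A0 A1.
pose L := \matrix_(i < 2, j < 2) (if i == 0 then [:: d; a]`_j else [:: 0; 1]`_j).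
have -> : A = L *m B.
  apply/row_matrixP => i; rewrite row_mul.
  have Lrow (r : 'rV[F]_2) : r *m B = r 0 0 *: row 0 B + r 0 1 *: row 1 B.
    rewrite mulmx_sum_row !big_ord_recl big_ord0 addr0.
    by have -> : lift ord0 ord0 = 1 :> 'I_2 by apply/val_inj.
  rewrite Lrow !mxE /=; case: i => [[|[|//]] Hi] /=.
  - by rewrite -A0; congr row; apply/val_inj.
  - by rewrite scale0r add0r scale1r -A1; congr row; apply/val_inj.
rewrite mxrankMfree // ltn_neqAle rank_leq_row andbT.
rewrite -[_ == _]/(row_free L) row_free_unit unitmxE unitfE negbK -det_tr det_trig.
  by rewrite !big_ord_recl big_ord0 !mxE /= mulr1 mulr1.
apply/is_trig_mxP => i j; rewrite !mxE.
by case: i => [[|[|//]] Hi]; case: j => [[|[|//]] Hj].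
Qed.

(** * Derivatives of matrix-valued maps *)

Lemma is_derive_mxP (R : realFieldType) (V : normedModType R) m n
    (M : V -> 'M[R]_(m, n)) (t v : V) (dM : 'M[R]_(m, n)) :
  is_derive t v M dM <->
  forall i j, is_derive t v (fun x => M x i j) (dM i j).
Proof.
split=> [[dM1 dM2] i j|dM1].
  apply: DeriveDef; first exact: (derivable_mxP M t v).1.
  by rewrite -dM2 derive_mx // mxE.
have dM0 : derivable M t v by apply/derivable_mxP => i j; case: (dM1 i j).
apply: DeriveDef => //; rewrite derive_mx //; apply/matrixP => i j.
by rewrite mxE; case: (dM1 i j).
Qed.

Lemma differentiable_mx (R : realType) (V : normedModType R) m n
    (M : V -> 'M[R]_(m, n)) (x : V) :
  (forall i j, differentiable (fun y => M y i j) x) -> differentiable M x.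
Proof.
move=> dM.
have -> : M = \sum_(i < m) \sum_(j < n) (fun y => M y i j *: delta_mx i j).
  apply/funext => y; rewrite fct_sumE [LHS]matrix_sum_delta.
  by apply: eq_bigr => i _; rewrite fct_sumE.
apply: differentiable_sum => i; apply: differentiable_sum => j.
exact: differentiableZl.
Qed.

Lemma is_derive_comp_coord (R : realType) n (phi : R -> R) (p v : 'rV[R]_n) i
    (dphi : R) : is_derive (p 0 i) 1 phi dphi ->
  differentiable (fun q : 'rV[R]_n => phi (q 0 i)) p /\
  is_derive p v (fun q : 'rV[R]_n => phi (q 0 i)) (v 0 i * dphi).
Proof.
case=> dp dpE; pose X (q : 'rV[R]_n) : R := q 0 i.
have dX : differentiable X p by exact: differentiable_coord.
have dphi' : differentiable phi (X p) by apply/derivable1_diffP.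
have dc : differentiable (phi \o X) p by exact: differentiable_comp.
split; first exact: dc.
apply: DeriveDef; first exact: diff_derivable.
rewrite -[LHS]/('D_v (phi \o X) p) deriveE // diff_comp //= diff1E //.
rewrite derive1E dpE /GRing.scale /=; congr (_ * _).
rewrite -deriveE //.
by have /is_derive_mxP/(_ 0 i)[] := is_derive_id p v.
Qed.

Lemma is_derive_constant (R : realFieldType) (V W : normedModType R) (f : V -> W)
    (a df : W) (x v : V) :
  (forall y, f y = a) -> is_derive x v f df -> df = 0.
Proof.
move=> fa [_ <-]; rewrite (_ : f = cst a) ?derive_cst //.
exact/funext.
Qed.

(** The two rows are the partial derivatives.  They determine the Jacobian only
    for a differentiable map, which is why differentiability is established
    first, entry by entry. *)
Lemma jacobian_ruled (R : realType) n (a b : R -> R) (g h : R -> 'rV[R]_n)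
    (p : 'rV[R]_2) (da db : R) (dg dh : 'rV[R]_n) :
  is_derive (p 0 1) 1 a da -> is_derive (p 0 1) 1 b db ->
  is_derive (p 0 0) 1 g dg -> is_derive (p 0 0) 1 h dh ->
  let J := 'J (fun q : 'rV[R]_2 =>
             a (q 0 1) *: g (q 0 0) + b (q 0 1) *: h (q 0 0)) p in
  row 0 J = a (p 0 1) *: dg + b (p 0 1) *: dh /\
  row 1 J = da *: g (p 0 0) + db *: h (p 0 0).
Proof.
move=> ha hb /is_derive_mxP hg /is_derive_mxP hh; set f := (fun q : 'rV[R]_2 => _) => /=.
have [fE dfE] : differentiable f p /\ forall v, 'D_v f p =
    v 0 0 *: (a (p 0 1) *: dg + b (p 0 1) *: dh) +
    v 0 1 *: (da *: g (p 0 0) + db *: h (p 0 0)).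
  have fcE i j : (fun q => f q i j) =
      (fun q : 'rV[R]_2 => a (q 0 1)) * (fun q : 'rV[R]_2 => g (q 0 0) i j) +
      (fun q : 'rV[R]_2 => b (q 0 1)) * (fun q : 'rV[R]_2 => h (q 0 0) i j).
    by apply/funext => q; rewrite !mxE.
  have H v := (is_derive_comp_coord v ha, is_derive_comp_coord v hb).
  have G v i j := (is_derive_comp_coord v (hg i j),
                   is_derive_comp_coord v (hh i j)).
  split=> [|v].
    apply: differentiable_mx => i j; rewrite fcE.
    have [[a1 _] [b1 _]] := H 0; have [[g1 _] [h1 _]] := G 0 i j.
    by apply: differentiableD; apply: differentiableM.
  suff [] : is_derive p v f (v 0 0 *: (a (p 0 1) *: dg + b (p 0 1) *: dh) +
    v 0 1 *: (da *: g (p 0 0) + db *: h (p 0 0))) by [].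
  apply/is_derive_mxP => i j; rewrite fcE.
  have [[_ a1] [_ b1]] := H v; have [[_ g1] [_ h1]] := G v i j.
  apply: is_derive_eq; rewrite !mxE /GRing.scale /=; ring.
by rewrite !rowE -!deriveEjacobian // !dfE !mxE /= !scale1r !scale0r addr0 add0r.
Qed.

(** * Vectors of three-space *)

Lemma row3P (T : Type) (x y : 'rV[T]_3) :
  x 0 0 = y 0 0 -> x 0 1 = y 0 1 -> x 0 2 = y 0 2 -> x = y.
Proof.
move=> h0 h1 h2; apply/rowP => -[[|[|[|//]]] Hi].
- by rewrite (_ : Ordinal Hi = 0) //; apply/val_inj.
- by rewrite (_ : Ordinal Hi = 1) //; apply/val_inj.
- by rewrite (_ : Ordinal Hi = 2) //; apply/val_inj.
Qed.

Lemma det_rows3 (R : comPzRingType) (x y z : 'rV[R]_3) :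
  \det (\matrix_(i < 3) [:: x; y; z]`_i) =
  x 0 0 * (y 0 1 * z 0 2 - y 0 2 * z 0 1) -
  x 0 1 * (y 0 0 * z 0 2 - y 0 2 * z 0 0) +
  x 0 2 * (y 0 0 * z 0 1 - y 0 1 * z 0 0).
Proof.
have e00 : lift ord0 (ord0 : 'I_2) = 1 :> 'I_3 by apply/val_inj.
have e01 : lift ord0 (lift ord0 (ord0 : 'I_1)) = 2 :> 'I_3 by apply/val_inj.
have e1 : lift (1 : 'I_3) (ord0 : 'I_2) = 0 :> 'I_3 by apply/val_inj.
have e11 : lift (1 : 'I_3) (lift ord0 (ord0 : 'I_1)) = 2 :> 'I_3 by apply/val_inj.
have e2 : lift (2 : 'I_3) (ord0 : 'I_2) = 0 :> 'I_3 by apply/val_inj.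
have e21 : lift (2 : 'I_3) (lift ord0 (ord0 : 'I_1)) = 1 :> 'I_3 by apply/val_inj.
have f0 : lift (lift ord0 (ord0 : 'I_1)) (ord0 : 'I_1) = ord0 :> 'I_2 by apply/val_inj.
rewrite (expand_det_row _ ord0) !big_ord_recl big_ord0 /cofactor.
rewrite !(expand_det_row _ ord0) !big_ord_recl !big_ord0 /cofactor !det_mx11.
rewrite !mxE /= ?(f0, e01, e00, e1, e11, e2, e21).
rewrite /bump /= !expr0 !expr1; ring.
Qed.

Lemma vec3E (R : realType) (a b d : R) :
  (vec3 a b d 0 0 = a) * (vec3 a b d 0 1 = b) * (vec3 a b d 0 2 = d).
Proof. by rewrite !mxE. Qed.

Lemma vec3_mul_rows (R : realType) (a b d : R) (x y z : 'rV[R]_3) :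
  vec3 a b d *m (\matrix_(i < 3) [:: x; y; z]`_i) = a *: x + b *: y + d *: z.
Proof.
apply/rowP => j; rewrite !mxE !big_ord_recl big_ord0 !mxE /=.
by rewrite addr0 addrA.
Qed.

Lemma dotcC (R : realType) (c : R) (x y : 'rV[R]_3) : dotc c x y = dotc c y x.
Proof. by rewrite /dotc; ring. Qed.

Lemma is_derive_dotc (R : realType) (c s : R) (f g : R -> 'rV[R]_3)
    (df dg : 'rV[R]_3) :
  is_derive s 1 f df -> is_derive s 1 g dg ->
  is_derive s 1 (fun u => dotc c (f u) (g u)) (dotc c df (g s) + dotc c (f s) dg).
Proof.
move=> /is_derive_mxP hf /is_derive_mxP hg.
have := (hf 0 0, hf 0 1, hf 0 2, hg 0 0, hg 0 1, hg 0 2) => -[[[[[f0 f1] f2] g0] g1] g2].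
have -> : (fun u => dotc c (f u) (g u)) =
    c *: ((fun u => f u 0 0) * (fun u => g u 0 0)) +
    (fun u => f u 0 1) * (fun u => g u 0 1) +
    (fun u => f u 0 2) * (fun u => g u 0 2).
  by apply/funext => u; rewrite /dotc -mulrA.
apply: is_derive_eq; rewrite /dotc /GRing.scale /=; ring.
Qed.

Lemma is_derive_wedgec (R : realType) (c s : R) (f g : R -> 'rV[R]_3)
    (df dg : 'rV[R]_3) :
  is_derive s 1 f df -> is_derive s 1 g dg ->
  is_derive s 1 (fun u => wedgec c (f u) (g u))
    (wedgec c df (g s) + wedgec c (f s) dg).
Proof.
move=> /is_derive_mxP hf /is_derive_mxP hg.
have D i j : is_derive s 1 (fun u => f u 0 i * g u 0 j - f u 0 j * g u 0 i)
    (df 0 i * g s 0 j + f s 0 i * dg 0 j - (df 0 j * g s 0 i + f s 0 j * dg 0 i)).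
  have := (hf 0 i, hf 0 j, hg 0 i, hg 0 j) => -[[[fi fj] gi] gj].
  have -> : (fun u => f u 0 i * g u 0 j - f u 0 j * g u 0 i) =
    (fun u => f u 0 i) * (fun u => g u 0 j) - (fun u => f u 0 j) * (fun u => g u 0 i).
    by apply/funext.
  apply: is_derive_eq; rewrite /GRing.scale /=; ring.
apply/is_derive_mxP => i0 j; rewrite ord1 {i0}.
case: j => [[|[|[|//]]] Hj].
- rewrite (_ : Ordinal Hj = 0); last exact/val_inj.
  have -> : (fun u => wedgec c (f u) (g u) 0 0) =
      c *: (fun u => f u 0 1 * g u 0 2 - f u 0 2 * g u 0 1).
    by apply/funext => u; rewrite /wedgec vec3E.
  have := D 1 2 => D12; apply: is_derive_eq.
  rewrite mxE /wedgec !vec3E /GRing.scale /=; ring.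
- rewrite (_ : Ordinal Hj = 1); last exact/val_inj.
  under eq_fun do rewrite /wedgec !vec3E.
  have := D 2 0 => D20; apply: is_derive_eq.
  rewrite mxE /wedgec !vec3E; ring.
- rewrite (_ : Ordinal Hj = 2); last exact/val_inj.
  under eq_fun do rewrite /wedgec !vec3E.
  have := D 0 1 => D01; apply: is_derive_eq.
  rewrite mxE /wedgec !vec3E; ring.
Qed.

(** * Frenet equations *)

Lemma is_derive_curve (R : realType) (g : R -> 'rV[R]_3) (n : nat) (s : R) :
  smooth g -> is_derive s 1 (derive1n n g) (derive1n n.+1 g s).
Proof.
move=> /(_ n s) dg; apply: DeriveDef; first exact: dg.
by rewrite derive1nS derive1E.
Qed.

Lemma arclength_unit (R : realType) (c : R) (g : R -> 'rV[R]_3) (s : R) :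
  arclength_param c g -> dotc c (frame_t g s) (frame_t g s) = 1.
Proof.
move=> /(_ s); rewrite /normc => h.
have [h0|h0] := leP 0 (dotc c (derive1 g s) (derive1 g s)).
  by rewrite -[LHS]sqr_sqrtr // h expr1n.
by move: h; rewrite ler0_sqrtr ?(ltW h0) // => /eqP; rewrite eq_sym oner_eq0.
Qed.

Lemma arclength_normal (R : realType) (c : R) (g : R -> 'rV[R]_3) (s : R) :
  smooth g -> arclength_param c g ->
  dotc c (frame_t g s) (derive1n 2 g s) = 0.
Proof.
move=> sg ag.
have dT := is_derive_curve 1 s sg.
have := is_derive_constant (fun u => arclength_unit u ag)
  (is_derive_dotc c dT dT).
by rewrite dotcC -mulr2n => /eqP; rewrite mulrn_eq0 /= => /eqP.
Qed.

(** Differentiating <gamma, gamma> = c twice gives <gamma'', gamma> = -1, so the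
    tangential projection of T' is T' + c gamma.  Then
    E' = T x T + gamma x T' = k gamma x (gamma x T) = - k T. *)
Lemma frame_equations_curved (R : realType) (c l : R) (g : R -> 'rV[R]_3)
    (k : R -> R) (s : R) :
  c = -1 \/ c = 1 -> smooth g -> (forall s, space_form c (g s)) ->
  arclength_param c g -> geodesic_curvature c l g k -> 0 <= s <= l ->
  derive1n 2 g s = k s *: frame_e c g s - c *: g s /\
  is_derive s 1 (frame_e c g) (- k s *: frame_t g s).
Proof.
move=> hc sg gM ag gk hs.
have c0 : (c == 0) = false by apply/eqP => c0; case: hc; lra.
have c2 : c * c = 1 by case: hc => ->; lra.
have gg u : dotc c (g u) (g u) = c.
  have := gM u; rewrite /space_form c0.
  by case: hc => -> ; [rewrite eqxx => -[]|case: eqP => // ?; lra].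
have dg u := is_derive_curve 0 u sg.
have dT u := is_derive_curve 1 u sg.
have gT u : dotc c (g u) (frame_t g u) = 0.
  have := is_derive_constant gg (is_derive_dotc c (dg u) (dg u)).
  by rewrite dotcC -mulr2n => /eqP; rewrite mulrn_eq0 /= => /eqP.
have gA : dotc c (derive1n 2 g s) (g s) = -1.
  have := is_derive_constant gT (is_derive_dotc c (dg s) (dT s)).
  have /= := arclength_unit s ag; rewrite /frame_t -!derive1n1 => -> h.
  by rewrite dotcC; lra.
have A : derive1n 2 g s = k s *: frame_e c g s - c *: g s.
  have [_] := gk s hs; rewrite /covariant_derivative.
  rewrite -[derive1 (frame_t g) s]/(derive1n 2 g s) gA mulrN1 scaleNr opprK => <-.
  by rewrite addrK.
split=> //.
have -> : frame_e c g = (fun u => wedgec c (g u) (frame_t g u)).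
  by rewrite /frame_e c0.
have := is_derive_wedgec c (dg s) (dT s).
move/is_derive_eq; apply; rewrite A /frame_e c0.
rewrite -[derive1n 1 g s]/(frame_t g s) -[derive1n 0 g s]/(g s).
have := gg s; have := gT s; rewrite /dotc.
set p := g s; set T := frame_t g s => h1 h2.
(* The two relations <p, T> = 0 and <p, p> = c are solved for the monomials that
   the coordinate at hand has to eliminate. *)
have p1T : p 0 1 * T 0 1 = - (c * p 0 0 * T 0 0) - p 0 2 * T 0 2 by lra.
have p2T : p 0 2 * T 0 2 = - (c * p 0 0 * T 0 0) - p 0 1 * T 0 1 by lra.
have p1p : p 0 1 * p 0 1 = c - c * p 0 0 * p 0 0 - p 0 2 * p 0 2 by lra.
have p2p : p 0 2 * p 0 2 = c - c * p 0 0 * p 0 0 - p 0 1 * p 0 1 by lra.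
apply: row3P; rewrite /wedgec !(vec3E, mxE) /=.
- ring: p1T p1p c2.
- ring: p2T p2p c2.
- ring: p1T p1p c2.
Qed.

(** In the plane, the wedge product with the unit normal is the rotation by a
    right angle, and det (x, y) is the inner product of y with the rotated x. *)
Lemma orthogonal_plane (R : realType) (x y : 'rV[R]_3) :
  x 0 0 = 0 -> y 0 0 = 0 -> dotc 0 x x = 1 -> dotc 0 x y = 0 ->
  y = (x 0 1 * y 0 2 - x 0 2 * y 0 1) *: wedgec 0 (vec3 1 0 0) x.
Proof.
rewrite /dotc !mul0r !add0r => x0 y0 xx xy.
have h1 : x 0 1 * y 0 1 = - (x 0 2 * y 0 2) by lra.
apply: row3P; rewrite mxE /wedgec !vec3E ?y0.
- by ring.
- have h2 : x 0 2 * x 0 2 = 1 - x 0 1 * x 0 1 by lra.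
  ring: h1 h2.
- have h2 : x 0 1 * x 0 1 = 1 - x 0 2 * x 0 2 by lra.
  ring: h1 h2.
Qed.

Lemma normc_scale_rotation (R : realType) (a : R) (x : 'rV[R]_3) :
  0 < a -> x 0 0 = 0 -> dotc 0 x x = 1 ->
  normc 0 (a *: wedgec 0 (vec3 1 0 0) x) = a.
Proof.
move=> a0 x0 xx; rewrite /normc (_ : dotc _ _ _ = a ^+ 2 * dotc 0 x x).
  by rewrite xx mulr1 sqrtr_sqr gtr0_norm.
by rewrite /dotc /wedgec !(vec3E, mxE) /=; ring.
Qed.

(** q = det(T, T') in the plane is positive where the curve turns
    counterclockwise, and there T' is q times T turned by a right angle.
    Positivity of the continuous function q at s extends to a neighbourhood,
    in which the normal is thus the rotated tangent, a function that can be
    differentiated. *)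
Lemma frame_equations_flat (R : realType) (l : R) (g : R -> 'rV[R]_3)
    (k : R -> R) (s : R) :
  smooth g -> (forall s, space_form 0 (g s)) -> arclength_param 0 g ->
  positively_oriented 0 l g -> geodesic_curvature 0 l g k -> 0 <= s <= l ->
  derive1n 2 g s = k s *: frame_e 0 g s /\
  is_derive s 1 (frame_e 0 g) (- k s *: frame_t g s).
Proof.
move=> sg gM ag og gk hs.
have n01 : (0 == -1 :> R) = false by apply/eqP; lra.
have g0 u : g u 0 0 = 0 by have := gM u; rewrite /space_form n01 eqxx.
have dg u := is_derive_curve 0 u sg.
have dT u := is_derive_curve 1 u sg.
have dA u := is_derive_curve 2 u sg.
have coord (f : R -> 'rV[R]_3) (df : 'rV[R]_3) (u : R) j : is_derive u 1 f df ->
    is_derive u 1 (fun x => f x 0 j) (df 0 j) by move/is_derive_mxP.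
have T0 u : frame_t g u 0 0 = 0.
  exact: (is_derive_constant g0 (coord _ _ _ 0 (dg u))).
have A0 u : derive1n 2 g u 0 0 = 0.
  exact: (is_derive_constant T0 (coord _ _ _ 0 (dT u))).
pose q u := frame_t g u 0 1 * derive1n 2 g u 0 2 -
            frame_t g u 0 2 * derive1n 2 g u 0 1.
pose E u := wedgec 0 (vec3 1 0 0) (frame_t g u).
have eE u : 0 < q u -> frame_e 0 g u = E u.
  move=> q0; have TT := arclength_unit u ag.
  have AE := orthogonal_plane (T0 u) (A0 u) TT (arclength_normal u sg ag).
  have nA := normc_scale_rotation q0 (T0 u) TT.
  rewrite /frame_e eqxx [X in normc 0 X]AE nA [X in _ *: X]AE.
  by rewrite scalerA mulVf ?scale1r // gt_eqF.
have qs : 0 < q s.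
  have := og s hs; rewrite det_rows3 /surface_normal /frame_e eqxx !vec3E.
  have : 0 <= (normc 0 (derive1n 2 g s))^-1 by rewrite invr_ge0 sqrtr_ge0.
  rewrite /q; set a := (_^-1); move: a (frame_t g s) (derive1n 2 g s) => a T D a0.
  rewrite !mxE; nra.
have q_cont : {for s, continuous q}.
  have dq : derivable q s 1.
    have := (coord _ _ _ 1 (dT s), coord _ _ _ 2 (dT s)) => -[T1 T2].
    have := (coord _ _ _ 1 (dA s), coord _ _ _ 2 (dA s)) => -[A1 A2].
    have -> : q = (fun u => frame_t g u 0 1) * (fun u => derive1n 2 g u 0 2) -
            (fun u => frame_t g u 0 2) * (fun u => derive1n 2 g u 0 1).
      by apply/funext.
    apply: derivableB; apply: derivableM.
    - exact: (@ex_derive _ _ _ _ _ _ _ T1).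
    - exact: (@ex_derive _ _ _ _ _ _ _ A2).
    - exact: (@ex_derive _ _ _ _ _ _ _ T2).
    - exact: (@ex_derive _ _ _ _ _ _ _ A1).
  exact/differentiable_continuous/derivable1_diffP.
have nearE : \near s, E s = frame_e 0 g s.
  have qnear : \forall u \near s, 0 < q u := cvgr_gt (q s) q_cont 0 qs.
  near=> u; apply/esym/eE; near: u; exact: qnear.
have A : derive1n 2 g s = k s *: frame_e 0 g s.
  by have [_] := gk s hs; rewrite /covariant_derivative mul0r scale0r subr0.
split=> //.
apply: (near_eq_is_derive nearE).
have := is_derive_wedgec 0 (is_derive_cst (vec3 1 0 0) s 1) (dT s).
move/is_derive_eq; apply; rewrite A eE // -[derive1n 1 g s]/(frame_t g s).
by apply: row3P; rewrite /E /wedgec !(vec3E, mxE) /= ?T0; ring.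
Unshelve. all: by end_near. Qed.

Lemma frame_equations (R : realType) (c l : R) (g : R -> 'rV[R]_3)
    (k : R -> R) (s : R) :
  [\/ c = -1, c = 0 | c = 1] -> smooth g -> (forall s, space_form c (g s)) ->
  arclength_param c g -> positively_oriented c l g ->
  geodesic_curvature c l g k -> 0 <= s <= l ->
  derive1n 2 g s = k s *: frame_e c g s - c *: g s /\
  is_derive s 1 (frame_e c g) (- k s *: frame_t g s).
Proof.
case=> -> sg gM ag og gk hs.
- by apply: (@frame_equations_curved R _ l) => //; left.
- by rewrite scale0r subr0; apply: (@frame_equations_flat R l).
- by apply: (@frame_equations_curved R _ l) => //; right.
Qed.

(** * The singular points of the family of geodesics *)

(** The splitting of the variation field: row 0 is ca times row 1 plus
    (C sa - kappa S) times w = sa T - ca E.  The point p of the curve enters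
    only through c p = c N, N being the normal to the surface; this covers the
    flat case, where p is unrelated to N, together with the others. *)
Lemma rank_jacobi_rows (R : realType) (c C S ca sa kappa : R)
    (p N T E : 'rV[R]_3) (J : 'M[R]_(2, 3)) :
  C ^+ 2 + c * S ^+ 2 = 1 -> ca ^+ 2 + sa ^+ 2 = 1 -> c *: p = c *: N ->
  0 < \det (\matrix_(i < 3) [:: N; T; E]`_i) ->
  row 0 J = C *: T +
    S *: (ca *: (kappa *: E - c *: p) + sa *: (- kappa *: T)) ->
  row 1 J = - (c * S) *: p + C *: (ca *: T + sa *: E) ->
  (\rank J < 2)%N = (C * sa - kappa * S == 0).
Proof.
move=> CS AB cN detM J0 J1.
pose M := \matrix_(i < 3) [:: N; T; E]`_i.
(* L holds the coordinates of w and of dF/dt in the basis (N, T, E).  Replacing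
   - c S by - S in the second row gives the right inverse X of L: the product of
   the two versions of that row is C^2 + c S^2 = 1. *)
pose L := \matrix_(i < 2)
  [:: vec3 0 sa (- ca); vec3 (- (c * S)) (C * ca) (C * sa)]`_i.
pose X := (\matrix_(i < 2)
  [:: vec3 0 sa (- ca); vec3 (- S) (C * ca) (C * sa)]`_i)^T.
have LX : L *m X = 1%:M.
  apply/matrixP => i j; rewrite !mxE !big_ord_recl big_ord0 !mxE.
  case: i => [[|[|//]] Hi]; case: j => [[|[|//]] Hj]; rewrite /= !mxE /=.
  - by rewrite -AB; ring.
  - by ring.
  - by ring.
  - have -> : 1%:R = C ^+ 2 * (ca ^+ 2 + sa ^+ 2) + c * S ^+ 2 by rewrite AB mulr1.
    by ring.
have freeB : row_free (L *m M).
  rewrite /row_free mxrankMfree; first by apply/row_freeP; exists X.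
  by rewrite row_free_unit unitmxE unitfE gt_eqF.
apply: (rank_triangular_rows (a := ca) freeB);
  rewrite !row_mul !rowK /= !vec3_mul_rows; apply/rowP => j;
  move/rowP/(_ j): cN; rewrite ?J0 ?J1 !mxE => cN.
- transitivity ((C * (ca ^+ 2 + sa ^+ 2) - kappa * S * sa) * T 0 j +
      kappa * S * ca * E 0 j - S * ca * (c * p 0 j)).
    by rewrite AB; ring.
  by rewrite cN; ring.
- have -> : - (c * S) * p 0 j = - S * (c * p 0 j) by ring.
  by rewrite cN; ring.
Qed.

Lemma singular_jacobian (R : realType) (c alpha l : R)
    (g : R -> 'rV[R]_3) (k : R -> R) (s t : R) :
  [\/ c = -1, c = 0 | c = 1] -> smooth g -> (forall s, space_form c (g s)) ->
  arclength_param c g -> positively_oriented c l g ->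
  geodesic_curvature c l g k -> 0 <= s <= l ->
  (\rank (DF_alpha c alpha g s t) < 2)%N =
  (cosc c t * sin alpha - k s * sinc c t == 0).
Proof.
move=> hc sg gM ag og gk hs.
have [A dE] := frame_equations hc sg gM ag og gk hs.
have dg := is_derive_curve 0 s sg.
have := is_derive_curve 1 s sg; rewrite A => dT.
have detM := og s hs.
rewrite -/(derive1n 1 g) in dT.
have cN : c *: g s = c *: surface_normal c (g s).
  by rewrite /surface_normal; case: eqP => // ->; rewrite !scale0r.
have dv : is_derive s 1 (v_alpha c alpha g)
    (cos alpha *: (k s *: frame_e c g s - c *: g s) +
     sin alpha *: (- k s *: frame_t g s)).
  have -> : v_alpha c alpha g =
      cos alpha *: (frame_t g) + sin alpha *: frame_e c g by apply/funext.
  exact: is_deriveD.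
set p : 'rV[R]_2 := \row_(i < 2) [:: s; t]`_i.
have p0 : p 0 0 = s by rewrite mxE.
have p1 : p 0 1 = t by rewrite mxE.
have := @jacobian_ruled R _ (cosc c) (sinc c) g (v_alpha c alpha g) p.
rewrite p0 p1 => /(_ _ _ _ _ (is_derive_cosc t hc)
  (is_derive_sinc t hc) dg dv).
rewrite -[derive1n 1 g s]/(frame_t g s).
rewrite -[jacobian _ _]/(DF_alpha c alpha g s t) => -[J0 J1].
have CS := cosc_sq_sinc_sq t hc.
have AB := cos2Dsin2 alpha.
exact: (rank_jacobi_rows CS AB cN detM J0 J1).
Qed.

(** This one equivalence yields the existence of the function rho, its formula and
    the parametrization of the evolutoid. *)
Lemma retained_critical_pointP (R : realType) (c alpha l : R)
    (g : R -> 'rV[R]_3) (k : R -> R) (s t : R) :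
  [\/ c = -1, c = 0 | c = 1] -> 0 <= alpha <= pi / 2 ->
  smooth g -> (forall s, space_form c (g s)) -> arclength_param c g ->
  positively_oriented c l g -> geodesic_curvature c l g k ->
  convex_curvature c l k -> 0 <= s <= l ->
  retained_critical_point c alpha l g s t <->
  t = arctanc c (sin alpha / k s).
Proof.
move=> hc /andP[a0 a1] sg gM ag og gk hk hs.
have sa0 : 0 <= sin alpha by apply: sin_ge0_pi; have := pi_gt0 R; lra.
have k0 : 0 < k s by have := hk s hs; case: eqP => // _ h; lra.
have m0 : 0 <= sin alpha / k s by apply: divr_ge0 => //; exact: ltW.
have m1 : c = -1 -> sin alpha / k s < 1.
  move=> cE; have := hk s hs; rewrite cE eqxx => k1.
  by rewrite ltr_pdivrMr // mul1r (le_lt_trans (sin_le1 _)).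
have [t0_ge0 t0_crit t0_min] := arctanc_first hc m0 m1.
have critE u : critical_point c alpha l g s u <->
    0 <= u /\ sinc c u = sin alpha / k s * cosc c u.
  have E : (\rank (DF_alpha c alpha g s u) < 2)%N <->
      sinc c u = sin alpha / k s * cosc c u.
    rewrite (@singular_jacobian R c alpha l g k) //.
    split=> [/eqP h|->]; last by apply/eqP; field; rewrite gt_eqF.
    have -> : sin alpha / k s * cosc c u = cosc c u * sin alpha / k s by ring.
    have -> : cosc c u * sin alpha = k s * sinc c u by lra.
    by field; rewrite gt_eqF.
  by split=> [[_ u0 /E]|[u0 /E]].
split=> [[/critE[t_ge0 tE] tmin]|->].
  have [le_t t_eq] := t0_min t t_ge0 tE.
  have [c1|/t_eq //] := pselect (c = 1).
  by apply/eqP; rewrite eq_le le_t andbT; apply: tmin => //; exact/critE.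
split=> [|_ u /critE[u0 uE]]; first exact/critE.
by have [] := t0_min u u0 uE.
Qed.

Unset Implicit Arguments.

Theorem proposition3p2 (R : realType) (c alpha l : R)
    (gamma : R -> 'rV[R]_3) (k : R -> R)
    (hc : [\/ c = -1, c = 0 | c = 1])
    (halpha : 0 <= alpha <= pi / 2)
    (hsmooth : smooth gamma)
    (hclosed : closed_curve l gamma)
    (hM : forall s, space_form c (gamma s))
    (harc : arclength_param c gamma)
    (horient : positively_oriented c l gamma)
    (hk : geodesic_curvature c l gamma k)
    (hconvex : convex_curvature c l k) :
  (exists rho : R -> R, singular_time c alpha l gamma rho) /\
  forall rho : R -> R, singular_time c alpha l gamma rho ->
    (forall s, 0 <= s <= l -> rho s = arctanc c (sin alpha / k s)) /\
    evolutoid c alpha l gamma =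
      [set expc c (gamma s) (rho s) (v_alpha c alpha gamma s)
         | s in [set s : R | 0 <= s <= l]].
Proof.
have retE s t := retained_critical_pointP t hc halpha
  hsmooth hM harc horient hk hconvex.
split=> [|rho hrho].
  by exists (fun s => arctanc c (sin alpha / k s)) => s hs; apply/retE.
have rhoE s : 0 <= s <= l -> rho s = arctanc c (sin alpha / k s).
  by move=> hs; apply/retE => //; exact: hrho.
split=> //; apply/seteqP; split=> [x [s [t [st ->]]]|x [s hs <-]].
  have hs : 0 <= s <= l by case: st => -[].
  exists s => //; rewrite rhoE //.
  by move/(retE _ _ hs) : st => ->.
by exists s, (rho s); split=> //; exact: hrho.
Qed.
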